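(* Let $U$ be a unicyclic graph on $n$ vertices. Then ${\rm pind}(A_{U})=1$. Hence $U$ is $(2,2)$-choosable.
   Context: Graphs are finite and simple. A unicyclic graph is a connected graph containing exactly one cycle (equivalently, a connected graph whose number of edges equals its number of vertices). The permanent of an $m\times m$ real matrix $A=[a_{ij}]$ is ${\rm per}(A)=\sum_{\sigma}\prod_{i=1}^{m}a_{i\sigma(i)}$, summed over all permutations $\sigma$ of $\{1,\ldots,m\}$. The permanent index ${\rm pind}(A)$ of a matrix $A$ with $m$ rows is the minimum integer $k$ such that there is an $m\times m$ matrix $A'$ with ${\rm per}(A')\neq 0$, each column of which is a column of $A$, and such that each column of $A$ occurs in $A'$ at most $k$ times. For a graph $G$, fix an orientation of its edges. $A_G$ is the matrix with rows indexed by the edges of $G$ and columns indexed by the vertices and edges of $G$, where for $e=(u,v)$ (oriented from $u$ to $v$), $A_G[e,y]=1$ if $y=v$ or $y\neq e$ is an edge incident to $v$; $A_G[e,y]=-1$ if $y=u$ or $y\neq e$ is an edge incident to $u$; and $A_G[e,y]=0$ otherwise. (Reversing an edge multiplies the corresponding row by $-1$, so ${\rm pind}(A_G)$ does not depend on the orientation.) A total-weighting of $G=(V,E)$ is a mapping $f:V\cup E\to\mathbb{R}$. For $v\in V$ put $s(v)=f(v)+\sum_{e\in E(v)}f(e)$, where $E(v)$ is the set of edges incident with $v$. The total-weighting $f$ is proper if $s(u)\neq s(v)$ for any two adjacent vertices $u,v$. The graph $G$ is $(k,k')$-choosable if for every assignment $L$ of a set $L(v)$ of $k$ real numbers to each vertex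 $v$ and a set $L(e)$ of $k'$ real numbers to each edge $e$, there is a proper total-weighting $f$ with $f(z)\in L(z)$ for all $z\in V\cup E$. *)

(* Defs.v *)
From HB Require Import structures.
From mathcomp Require Import all_boot all_order all_algebra all_fingroup.
From mathcomp Require Import finmap reals.

Set Implicit Arguments.
Unset Strict Implicit.
Unset Printing Implicit Defensive.

Import Order.TTheory GRing.Theory Num.Theory.
Local Open Scope ring_scope.

Record sgraph := SGraph {
  vertex :> finType;
  adj : rel vertex;
  adj_sym : symmetric adj;
  adj_irr : irreflexive adj }.

Arguments adj {s} : rename.

(* An edge is the unordered pair of its ends. *)
Definition edge_set (G : sgraph) : {set {set G}} :=
  [set [set p.1; p.2] | p in [set p : G * G | adj p.1 p.2]].

Notation edge G := {E : {set vertex G} | E \in edge_set G}.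

(* [inl v] is the vertex [v], [inr e] the edge [e]. *)
Notation velt G := (vertex G + edge G)%type.

Section Unicyclic.
Variable G : sgraph.

Definition connected : Prop := forall x y : G, connect adj x y.

(* A cycle is identified with its edge set, so that the closed walks obtained
   from one another by rotation or reversal are the same cycle. *)
Definition is_cycle (C : {set {set G}}) : Prop :=
  exists s : seq G,
    [/\ (2 < size s)%N, ucycle adj s & C = [set [set x; next s x] | x in s]].

Definition unicyclic : Prop :=
  connected /\ exists! C : {set {set G}}, is_cycle C.

End Unicyclic.

Section PermanentIndex.
Variable R : realType.

Definition permanent (m : nat) (A : 'M[R]_m) : R :=
  \sum_(s : 'S_m) \prod_(i < m) A i (s i).

(* [c] selects the columns of A'; multiplicities count column indices, so two
   columns of A with the same entries are still different columns. *)
Definition pind_le (m p : nat) (A : 'M[R]_(m, p)) (k : nat) : Prop :=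
  exists c : 'I_m -> 'I_p,
    permanent (\matrix_(i, j) A i (c j)) <> 0 /\
    forall y : 'I_p, (#|[set j | c j == y]| <= k)%N.

(* pind(A) = k; no such k exists when every A' has permanent zero. *)
Definition is_pind (m p : nat) (A : 'M[R]_(m, p)) (k : nat) : Prop :=
  pind_le A k /\ forall k' : nat, pind_le A k' -> (k <= k')%N.

End PermanentIndex.

Section OrientationMatrix.
Variable G : sgraph.

(* [o e = (u, v)] means that e is oriented from u to v. *)
Definition orientation (o : edge G -> G * G) : Prop :=
  forall e : edge G, val e = [set (o e).1; (o e).2].

Lemma orientation_exists : exists o, orientation o.
Proof.
have h (e : edge G) : exists p : G * G, val e == [set p.1; p.2].
  by case: e => E /= /imsetP [p _ ->]; exists p.
by exists (fun e => xchoose (h e)) => e; apply/eqP; exact: (xchooseP (h e)).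
Qed.

Definition AG_entry (R : realType) (o : edge G -> G * G)
    (e : edge G) (y : velt G) : R :=
  let: (u, v) := o e in
  match y with
  | inl w => if w == v then 1 else if w == u then -1 else 0
  | inr e' => if (e' != e) && (v \in val e') then 1
              else if (e' != e) && (u \in val e') then -1 else 0
  end.

Definition AG (R : realType) (o : edge G -> G * G) :
    'M[R]_(#|{: edge G}|, #|{: velt G}|) :=
  \matrix_(i, j) AG_entry R o (enum_val i) (enum_val j).

End OrientationMatrix.

Section TotalWeighting.
Variables (R : realType) (G : sgraph).

Definition vsum (f : velt G -> R) (v : G) : R :=
  f (inl v) + \sum_(e : edge G | v \in val e) f (inr e).

Definition proper_weighting (f : velt G -> R) : Prop :=
  forall u v : G, adj u v -> vsum f u <> vsum f v.

Definition choosable (k k' : nat) : Prop :=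
  forall L : velt G -> {fset R},
    (forall v : G, #|` L (inl v)| = k) ->
    (forall e : edge G, #|` L (inr e)| = k') ->
    exists f : velt G -> R, proper_weighting f /\ forall z, f z \in L z.

End TotalWeighting.

(* Main.v *)
Require Import Defs.
From mathcomp Require Import all_boot all_order all_algebra all_fingroup.
From mathcomp Require Import finmap reals.

(** In the matrix A_U the column of an edge xy is the sum of the columns of x
    and y [AG_entry_edge]: on the row of xy the two contributions cancel, and
    no other edge meets both x and y.

    Pick an edge e = uv of the unique cycle.  Then U - e is a spanning tree;
    root it at u and send each tree edge to its lower end and e to u.  This is
    a bijection h from edges to vertices [unicyclic_rooted], so the vertex
    columns number exactly as many as the rows.  By multilinearity in the
    columns [permanent_cycle_edge], replacing the column of u by that of e gives

      per(V - u + e) = per(V) + per(V with v in place of u).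

    The last permanent is nonzero.  A nonzero term directs every edge to one of
    its ends so that u receives none, v receives two and every other vertex one;
    from the root downwards this forces each tree edge to its lower end, and
    e to v [head_rigid].  So all nonzero terms are equal, and in characteristic
    zero they do not cancel [permanent_rigid].  Hence V or V - u + e is a set of
    distinct columns with nonzero permanent, which is the bound pind <= 1.

    Choosability follows by the multilinear case of the Combinatorial
    Nullstellensatz.  With two allowed values at each element, start from one
    choice everywhere and switch the values on a subset S of the elements whose
    columns were selected.  The alternating sum over S of the product of the
    quantities s(v) - s(u) over all edges is, up to sign, the permanent of the
    selected columns times the product of the differences of the two values
    [permanent_alternating_sum]; as it is nonzero, some S makes every factor
    nonzero. *)

Set Implicit Arguments.
Unset Strict Implicit.
Unset Printing Implicit Defensive.

Import GRing.Theory Num.Theory.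

(** * Permanents *)

Section Permanents.
Local Open Scope ring_scope.
Variables (R : realType) (m : nat).
Implicit Types (A B C : 'M[R]_m) (a : 'I_m -> R).

(** Toggling membership of [j] pairs the subsets off with opposite signs. *)
Lemma alternating_sum_eq0 (T : finType) (j : T) (F : {set T} -> R) :
  (forall S : {set T}, j \notin S -> F (j |: S) = F S) ->
  \sum_(S : {set T}) (-1) ^+ #|S| * F S = 0.
Proof.
move=> Fj; rewrite (bigID (fun S : {set T} => j \in S)) /=.
rewrite (reindex_onto (fun S : {set T} => j |: S) (fun S => S :\ j)) /=;
  last first.
  by move=> S; exact: setD1K.
rewrite (eq_bigl (fun S : {set T} => j \notin S)) => [|S]; last first.
  rewrite setU11 /=; apply/eqP/idP => [<-|/setU1K //].
  by rewrite !inE eqxx.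
rewrite -big_split big1 //= => S jS.
by rewrite Fj // cardsU1 jS exprS mulN1r mulNr addNr.
Qed.

(** In the expansion of a product of affine forms, a term selects from the row
    [i] either the constant ([None]) or the [j]-th linear term ([Some j]); the
    permutations are the selections that use every linear term. *)
Definition perm_option (s : 'S_m) : {ffun 'I_m -> option 'I_m} :=
  [ffun i => Some (s i)].

Lemma perm_option_inj : injective perm_option.
Proof.
move=> s t /ffunP st; apply/permP => i.
by have := st i; rewrite !ffunE => -[].
Qed.

Lemma onto_perm_option (g : {ffun 'I_m -> option 'I_m}) :
  (forall j, exists i, g i = Some j) -> exists s, g = perm_option s.
Proof.
move=> /fin_all_exists [k gk].
have k_inj : injective k by move=> i j kij; apply: Some_inj; rewrite -!gk kij.
exists (perm k_inj)^-1%g; apply/ffunP => i; rewrite ffunE -gk.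
by rewrite -[in RHS](permE k_inj) permKV.
Qed.

(** Ryser's formula with an affine perturbation.  Expanding the products, a
    selection of terms that misses the column [j] is insensitive to [j]
    belonging to [S] and cancels out; a selection that meets all [m] columns is
    a permutation, and only [S = setT] allows it.  The constants [a] disappear
    since such a selection leaves no row for them. *)
Lemma permanent_alternating_sum A a :
  \sum_(S : {set 'I_m}) (-1) ^+ #|S| * \prod_i (a i + \sum_(j in S) A i j)
  = (-1) ^+ m * permanent A.
Proof.
pose N i (o : option 'I_m) := if o is Some j then A i j else a i.
pose ok (S : {set 'I_m}) o : bool := if o is Some j then j \in S else true.
have factorE (S : {set _}) i :
    a i + \sum_(j in S) A i j = \sum_o (ok S o)%:R * N i o.
  rewrite (bigD1 None) //= mul1r; congr (_ + _).
  rewrite (reindex_omap Some id) /=; last by case.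
  rewrite [RHS](eq_bigl xpredT) => [|j]; last by rewrite eqxx.
  rewrite big_mkcond; apply: eq_bigr => j _.
  by case: (j \in S); rewrite ?mul1r ?mul0r.
under eq_bigr => S _.
  under eq_bigr => i _ do rewrite factorE.
  rewrite bigA_distr_bigA big_distrr /=; over.
rewrite exchange_big /=.
under eq_bigr => g _.
  under eq_bigr => S _ do rewrite big_split mulrA /=.
  rewrite -big_distrl /=; over.
(* The sum over all selections is split into permutations and the others. *)
rewrite (bigID (mem (perm_option @: setT))) /= addrC big1 ?add0r; last first.
  move=> g gNperm.
  have [j gj] : exists j, forall i, g i <> Some j.
    case/boolP: [exists j, forall i, g i != Some j].
      by case/existsP=> j /forallP gj; exists j => i; apply/eqP.
    rewrite negb_exists => /forallP onto.
    case: (onto_perm_option (g := g)) => [j|s gs].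
      have := onto j; rewrite negb_forall => /existsP [i].
      by rewrite negbK => /eqP; exists i.
    by case/negP: gNperm; rewrite gs imset_f.
  rewrite (alternating_sum_eq0 (j := j)) ?mul0r // => S _.
  apply: eq_bigr => i _; have := gj i; case: (g i) => [k|] //= kj.
  by rewrite !inE; case: eqP => // kj'; case: kj; rewrite kj'.
rewrite big_imset /=; last by move=> s t _ _ /perm_option_inj.
rewrite big_distrr /=; apply: eq_big => [s|s _]; first by rewrite inE.
congr (_ * _); last by apply: eq_bigr => i _; rewrite ffunE.
rewrite (bigD1 setT) //= [X in _ + X]big1 ?addr0 => [|S S_neqT].
  rewrite cardsT card_ord big1 ?mulr1 // => i _.
  by rewrite ffunE /= inE.
have [j jS] : exists j, j \notin S.
  apply/existsP; apply: contraNT S_neqT; rewrite negb_exists => /forallP jS.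
  by apply/eqP/setP => j; rewrite inE; apply/negbNE.
rewrite (bigD1 ((s^-1)%g j)) //= ffunE permKV /= (negbTE jS).
by rewrite mul0r mulr0.
Qed.

(** The multilinear Combinatorial Nullstellensatz on the cube of subsets. *)
Lemma permanent_neq0_subset A a : permanent A <> 0 ->
  exists S : {set 'I_m}, forall i, a i + \sum_(j in S) A i j <> 0.
Proof.
move=> A_neq0; pose P (S : {set 'I_m}) := \prod_i (a i + \sum_(j in S) A i j).
have [S PS | P0] := pickP (fun S => P S != 0).
  by exists S => i /eqP; apply/negP; move/prodf_neq0: PS; apply.
case: A_neq0; apply/eqP; have := permanent_alternating_sum A a.
rewrite big1 => [/esym/eqP|S _]; last first.
  by rewrite -/(P S) (eqP (negbFE (P0 S))) mulr0.
by rewrite mulf_eq0 signr_eq0.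
Qed.

Lemma permanent_scale_col A (t : 'I_m -> R) :
  permanent (\matrix_(i, j) (A i j * t j)) = permanent A * \prod_j t j.
Proof.
rewrite /permanent big_distrl /=; apply: eq_bigr => s _.
under eq_bigr do rewrite mxE.
rewrite big_split /=; congr (_ * _).
by rewrite [RHS](reindex_inj (@perm_inj _ s)).
Qed.

Lemma permanentD_col A B C k :
    (forall i, A i k = B i k + C i k) ->
    (forall i j, j != k -> A i j = B i j) ->
    (forall i j, j != k -> A i j = C i j) ->
  permanent A = permanent B + permanent C.
Proof.
move=> Ak AB AC; rewrite /permanent -big_split /=; apply: eq_bigr => s _.
set i0 := (s^-1)%g k; rewrite (bigD1 i0) //= [X in _ = X + _](bigD1 i0) //=.
rewrite [X in _ = _ + X](bigD1 i0) //= permKV Ak mulrDl.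
have s_neq i : i != i0 -> s i != k.
  by apply: contraNneq => sik; rewrite /i0 -sik permK.
by congr (_ * _ + _ * _); apply: eq_bigr => i /s_neq; [exact: AB | exact: AC].
Qed.

(** If all nonvanishing terms of a permanent coincide, their sum is a positive
    multiple of one of them, hence nonzero in characteristic zero. *)
Lemma permanent_rigid A (w : 'I_m -> R) :
    (forall i, w i != 0) ->
    (exists s : 'S_m, forall i, A i (s i) = w i) ->
    (forall s : 'S_m, (forall i, A i (s i) != 0) -> forall i, A i (s i) = w i) ->
  permanent A != 0.
Proof.
move=> w_neq0 [s0 As0] rigid; set W := \prod_i w i.
have W_neq0 : W != 0 by apply/prodf_neq0 => i _.
pose good (s : 'S_m) := [forall i, A i (s i) != 0].
rewrite /permanent (bigID good) /= [X in _ + X]big1 ?addr0; last first.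
  move=> s; rewrite negb_forall => /existsP [i]; rewrite negbK => /eqP Ai.
  by rewrite (bigD1 i) //= Ai mul0r.
rewrite (eq_bigr (fun=> W)) => [|s /forallP gs]; last first.
  by apply: eq_bigr => i _; apply: rigid.
rewrite sumr_const mulrn_eq0 negb_or W_neq0 andbT -lt0n.
by apply/card_gt0P; exists s0; apply/forallP => i; rewrite As0.
Qed.

End Permanents.

(** * Spanning trees in unicyclic graphs *)

Section Edges.
Variable G : sgraph.

Lemma adj_edge (x y : G) : adj x y -> [set x; y] \in edge_set G.
Proof. by move=> xy; apply/imsetP; exists (x, y); rewrite ?inE. Qed.

Lemma edge_adj (f : edge G) : exists x y, adj x y /\ val f = [set x; y].
Proof.
by case: f => E /= /imsetP [[x y]]; rewrite inE /= => xy ->; exists x, y.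
Qed.

Definition edge_of (x y : G) (xy : adj x y) : edge G :=
  exist (fun E : {set G} => E \in edge_set G) [set x; y] (adj_edge xy).

End Edges.

Section RootedTree.

(** A parent map with a decreasing depth: [d] is the distance to the root, and
    the parent is the next vertex of a shortest path. *)
Lemma connect_root_depth (T : finType) (r : rel T) (root : T) :
    (forall z, connect r z root) ->
  exists (p : T -> T) (d : T -> nat),
    forall z, z != root -> r z (p z) /\ d (p z) < d z.
Proof.
move=> conn.
pose reach z k := [exists s : k.-tuple T, path r z s && (last z s == root)].
have reachP z s : path r z s -> last z s = root -> reach z (size s).
  by move=> zs sr; apply/existsP; exists (in_tuple s); rewrite /= zs sr eqxx.
have ex_reach z : exists k, reach z k.
  by have /connectP [s zs sr] := conn z; exists (size s); apply: reachP.
pose d z := ex_minn (ex_reach z).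
have step z : exists y, z != root -> r z y /\ d y < d z.
  case: (eqVneq z root) => [_|z_neq]; first by exists z.
  rewrite {2}/d; case: ex_minnP => k /existsP [[s /= /eqP <-]].
  case: s => [|y s] /=; first by rewrite (negbTE z_neq).
  move=> /andP [/andP [zy ys] /eqP sr]; exists y => _; split=> //.
  by rewrite ltnS /d; case: ex_minnP => l _; apply; apply: reachP.
have [p pP] := fin_all_exists step.
by exists p, d.
Qed.

Variables (G : sgraph) (e : edge G).

Definition adj_without : rel G :=
  fun x y => adj x y && ([set x; y] != val e).

Lemma adj_without_sym : symmetric adj_without.
Proof. by move=> x y; rewrite /adj_without adj_sym setUC. Qed.

Variables (u : G) (p : G -> G) (d : G -> nat).
Hypothesis parent : forall z, z != u -> adj_without z (p z) /\ d (p z) < d z.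
Hypothesis acyclic : forall s : seq G,
  2 < size s -> ucycle adj_without s -> False.

Let tree x y := (x != u) && (y == p x) || (y != u) && (x == p y).

Let tree_sym : symmetric tree.
Proof. by move=> x y; rewrite /tree orbC. Qed.

Let tree_adj : subrel tree adj_without.
Proof.
move=> x y /orP [] /andP [xu /eqP ->]; first by case: (parent xu).
by rewrite adj_without_sym; case: (parent xu).
Qed.

Let tree_connect x y : connect tree x y.
Proof.
have to_root z : connect tree z u.
  move Ek: (d z) => k; elim/ltn_ind: k z Ek => k IH z Ek.
  have [-> //|zu] := eqVneq z u; have [_ dp] := parent zu.
  apply: (connect_trans (y := p z)).
    by apply: connect1; rewrite /tree zu eqxx.
  by apply: (IH (d (p z))) => //; rewrite -Ek.
by apply: (connect_trans (to_root x)); rewrite (sym_connect_sym tree_sym).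
Qed.

(** Every edge other than [e] joins a vertex to its parent: otherwise it would
    close the tree path between its ends into a cycle avoiding [e]. *)
Lemma adj_without_tree x y :
  adj_without x y -> (x != u) && (y == p x) || (y != u) && (x == p y).
Proof.
move=> xy; apply: contraT => ntree.
have /connectP [s0 xs0 y_last] := tree_connect x y.
case/shortenP: xs0 y_last => s xs uniq_s _ y_last.
exfalso; apply: (acyclic (s := x :: s)).
  case: s xs y_last {uniq_s} => [|a [|b s]] //=.
    by move=> _ yx; move: xy; rewrite yx /adj_without adj_irr.
  by rewrite andbT => xa ya; case/negP: ntree; rewrite ya.
rewrite /ucycle uniq_s andbT /= rcons_path -y_last adj_without_sym xy andbT.
exact: (sub_path tree_adj).
Qed.

(** Each edge other than [e] goes to its lower end and [e] to the root.  Two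
    vertices cannot be parents of one another, the depth being decreasing, which
    makes the lower end of a parent edge unambiguous. *)
Lemma tree_children : exists h : edge G -> G,
  [/\ bijective h, h e = u
    & forall f, f != e -> val f = [set h f; p (h f)] /\ d (p (h f)) < d (h f)].
Proof.
have child (f : edge G) :
    exists z, if f == e then z = u else z != u /\ val f = [set z; p z].
  case: eqP => [_|/eqP fe]; first by exists u.
  have [x [y [xy fE]]] := edge_adj f.
  have xy' : adj_without x y.
    by rewrite /adj_without xy -fE; apply: contraNneq fe => /val_inj ->.
  case/orP: (adj_without_tree xy') => /andP [zu /eqP zp].
    by exists x; rewrite fE -zp.
  by exists y; rewrite fE -zp setUC.
have [h hP] := fin_all_exists child.
have he : h e = u by have := hP e; rewrite eqxx.
have hN f : f != e -> h f != u /\ val f = [set h f; p (h f)].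
  by move=> fe; have := hP f; rewrite (negbTE fe).
have h_inj : injective h.
  move=> f g hfg; have [fe|/hN [fu fE]] := eqVneq f e.
    apply/eqP; apply: contraT => gf.
    by case: (hN g); rewrite 1?eq_sym -?hfg -?fe // -he fe eqxx.
  have [ge|/hN [_ gE]] := eqVneq g e; first by rewrite hfg ge he eqxx in fu.
  by apply: val_inj; rewrite fE gE hfg.
have h_onto z : exists f, h f = z.
  have [->|zu] := eqVneq z u; first by exists e.
  have [/andP [zp zpe] dz] := parent zu.
  pose f : edge G := edge_of zp.
  have /hN [fu fE] : f != e by apply: contraNneq zpe => <-.
  exists f; have: z \in val f by rewrite /= set21.
  rewrite fE => /set2P [//|z_p].
  have: h f \in val f by rewrite fE set21.
  case/set2P=> // hz; have [_] := parent fu.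
  by rewrite -z_p hz ltnNge ltnW.
have [k kP] := fin_all_exists h_onto.
exists h; split=> //; first by exists k => // f; apply: h_inj; rewrite kP.
by move=> f /hN [fu fE]; split=> //; case: (parent fu).
Qed.

End RootedTree.

(** The edge [e] is taken on the cycle: the rest of the cycle then connects its
    ends, so that [U - e] is connected, and a cycle of [U - e] would be a cycle
    of [U] other than the given one, as its edge set misses [e]. *)
Lemma unicyclic_rooted (U : sgraph) : unicyclic U ->
  exists (e : edge U) (h : edge U -> U) (v : U) (p : U -> U) (d : U -> nat),
  [/\ bijective h, v != h e, val e = [set h e; v]
    & forall f, f != e -> val f = [set h f; p (h f)] /\ d (p (h f)) < d (h f)].
Proof.
case=> conn [C [[s [s_gt2 /andP [s_cycle s_uniq] CE]] C_uniq]].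
case: s => [|x [|y [|z t]]] // in s_gt2 s_cycle s_uniq CE.
set q := z :: t in s_cycle s_uniq CE.
have xy : adj x y by case/andP: s_cycle.
pose e : edge U := edge_of xy.
have eC : val e \in C.
  by rewrite CE; apply/imsetP; exists x; rewrite ?mem_head //= eqxx.
have acyclic (s : seq U) : 2 < size s -> ucycle (adj_without e) s -> False.
  move=> s2 /andP [sc su].
  have sC : is_cycle [set [set a; next s a] | a in s].
    exists s; split=> //; rewrite /ucycle su andbT.
    by apply: sub_cycle sc => a b /andP [].
  move: eC; rewrite (C_uniq _ sC) => /imsetP [a a_s eE].
  by have /andP [_] := next_cycle sc a_s; rewrite -eE eqxx.
have yx : connect (adj_without e) y x.
  move: s_cycle s_uniq; rewrite /= rcons_path.
  move=> /and3P [_ yz /andP [zt tx]] /and3P [xq yq _].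
  have x_y : x != y by apply: contraNneq xq => ->; rewrite mem_head.
  have yq' : path (adj_without e) y q.
    apply: (@sub_in_path _ (predC1 x) adj); last by rewrite /= yz.
      move=> a b /= ax bx ab; rewrite /adj_without ab /=.
      apply: contraNneq ax => abE.
      have /set2P [-> //|xb] : x \in [set a; b] by rewrite abE /= set21.
      by case/eqP: bx.
    by apply/allP => a a_in /=; apply: contraNneq xq => <-.
  apply: (connect_trans (y := last z t)).
    by apply/connectP; exists q.
  apply: connect1; rewrite /adj_without tx /=.
  apply: contraNneq yq => txE.
  have /set2P [->|y_x] : y \in [set last z t; x] by rewrite txE /= set22.
    exact: mem_last.
  by rewrite y_x eqxx in x_y.
have sym_conn := sym_connect_sym (adj_without_sym e).
have conn' a b : connect (adj_without e) a b.
  apply: connect_sub (conn a b) => c f cf.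
  have [cfe|] := eqVneq [set c; f] (val e); last first.
    by move=> cfe; apply: connect1; rewrite /adj_without cf cfe.
  have c_f : c != f by apply: contraTneq cf => ->; rewrite adj_irr.
  have /set2P cE : c \in val e by rewrite -cfe set21.
  have /set2P fE : f \in val e by rewrite -cfe set22.
  case: cE c_f => ->; case: fE => ->; rewrite ?eqxx // => _.
  by rewrite sym_conn.
have [p [d pd]] := connect_root_depth (fun z => conn' z x).
have [h [h_bij hx hP]] := tree_children pd acyclic.
exists e, h, y, p, d; split; rewrite ?hx //.
by apply: contraTneq (xy) => ->; rewrite adj_irr.
Qed.

(** * The matrix A_G and total-weightings *)

Section Incidence.
Local Open Scope ring_scope.
Variables (R : realType) (G : sgraph).
Implicit Types (x y : G) (f g : edge G) (z : velt G).

(** Whether the weight of [z] counts in the sum at the vertex [x].  In terms of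
    these coefficients the row of [f = (u, v)] in A_G is the difference of the
    coefficients at [v] and at [u], also in the column of [f] itself, where both
    are [1]. *)
Definition covers (z : velt G) x : R :=
  match z with inl w => (w == x)%:R | inr g => (x \in val g)%:R end.

Lemma vsum_covers (w : velt G -> R) x : vsum w x = \sum_z covers z x * w z.
Proof.
rewrite big_sumType /= /vsum; congr (_ + _).
  rewrite (bigD1 x) //= eqxx mul1r big1 ?addr0 // => y /negbTE ->.
  by rewrite mul0r.
rewrite big_mkcond; apply: eq_bigr => g _.
by case: (x \in val g); rewrite ?mul1r ?mul0r.
Qed.

Lemma edge_ends_neq f x y : val f = [set x; y] -> x != y.
Proof.
have [a [b [ab ->]]] := edge_adj f => ab_xy.
have a_b : a != b by apply: contraTneq ab => ->; rewrite adj_irr.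
apply: contraNneq a_b => xy; move: ab_xy; rewrite xy setUid => ab_y.
have /set1P -> : a \in [set y] by rewrite -ab_y set21.
by have /set1P -> : b \in [set y] by rewrite -ab_y set22.
Qed.

Lemma covers_edge g x y w : val g = [set x; y] ->
  covers (inr g) w = covers (inl x) w + covers (inl y) w.
Proof.
move=> gE; have := edge_ends_neq gE; rewrite /covers gE !inE ![w == _]eq_sym.
by case: (x =P w) => [->|_]; case: (y =P w) => [->|_];
  rewrite ?eqxx ?addr0 ?add0r.
Qed.

Variables (o : edge G -> G * G) (oP : orientation o).

Lemma AG_entry_covers f z :
  AG_entry R o f z = covers z (o f).2 - covers z (o f).1.
Proof.
have := oP f; rewrite /AG_entry; case: (o f) => u v fE.
have uv : u != v := edge_ends_neq fE.
have [uf vf] : u \in val f /\ v \in val f by rewrite fE set21 set22.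
case: z => [w|g] /=.
  case: (eqVneq w v) => [->|_]; last by case: (w == u); rewrite sub0r ?oppr0.
  by rewrite eq_sym (negbTE uv) subr0.
case: (eqVneq g f) => [->|gf] /=; first by rewrite uf vf subrr.
case: (boolP (v \in val g)) => vg; case: (boolP (u \in val g)) => ug;
  rewrite ?subr0 ?sub0r ?oppr0 //.
case/eqP: gf; apply: val_inj; rewrite fE.
have [a [b [_ gE]]] := edge_adj g.
move: ug vg; rewrite gE => /set2P [] uE /set2P [] vE; rewrite uE vE // in uv *.
- by rewrite eqxx in uv.
- by rewrite setUC.
- by rewrite eqxx in uv.
Qed.

Lemma AG_entry_edge f g x y : val g = [set x; y] ->
  AG_entry R o f (inr g) = AG_entry R o f (inl x) + AG_entry R o f (inl y).
Proof.
by move=> gE; rewrite !AG_entry_covers !(covers_edge _ gE) opprD addrACA.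
Qed.

Lemma AG_entry_vertex_neq0 f x : (AG_entry R o f (inl x) != 0) = (x \in val f).
Proof.
rewrite oP !inE /AG_entry; case: (o f) => u v /=.
case: (x == v); first by rewrite oner_eq0 orbT.
by case: (x == u); rewrite ?oppr_eq0 ?oner_eq0 ?eqxx.
Qed.

Lemma vsum_AG_entry (w : velt G -> R) f :
  vsum w (o f).2 - vsum w (o f).1 = \sum_z AG_entry R o f z * w z.
Proof.
rewrite !vsum_covers -sumrB; apply: eq_bigr => z _.
by rewrite AG_entry_covers mulrBl.
Qed.

(** A weighting multiplied by A_G lists the differences of the sums along the
    edges, so that it is proper when no coordinate vanishes. *)
Lemma AG_entry_proper (w : velt G -> R) :
  (forall f, \sum_z AG_entry R o f z * w z <> 0) -> proper_weighting w.
Proof.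
move=> w_neq x y xy sxy; pose f : edge G := edge_of xy.
apply: (w_neq f); rewrite -vsum_AG_entry; apply/eqP; rewrite subr_eq0.
have := oP f; rewrite /=; case: (o f) => a b /= fE.
have /set2P aE : a \in [set x; y] by rewrite fE set21.
have /set2P bE : b \in [set x; y] by rewrite fE set22.
by case: aE => ->; case: bE => ->; rewrite ?sxy.
Qed.

Definition edge_row (j : 'I_#|{: edge G}|) : edge G := enum_val j.

(** The square submatrix of a choice of columns.  The choice is indexed by the
    edges, like the rows, because columns will be described by a matching of
    the edges with vertices. *)
Definition column_matrix (c : edge G -> velt G) : 'M[R]_#|{: edge G}| :=
  \matrix_(i, j) AG_entry R o (edge_row i) (c (edge_row j)).

Lemma pind_le1 (c : edge G -> velt G) :
  injective c -> permanent (column_matrix c) <> 0 -> pind_le (AG R o) 1.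
Proof.
move=> c_inj per_neq0; exists (fun j => enum_rank (c (edge_row j))); split.
  rewrite (_ : \matrix_(i, j) _ = column_matrix c) //.
  by apply/matrixP => i j; rewrite !mxE enum_rankK.
move=> y; apply/card_le1P => i; rewrite inE => /eqP iy j; rewrite !inE -iy.
by rewrite (inj_eq enum_rank_inj) (inj_eq c_inj) (inj_eq enum_val_inj).
Qed.

(** [a] and [b] list the two values allowed at each element.  The weighting
    equals [b] on [chosen] and [a] elsewhere; the elements outside the selected
    columns only contribute to the constants [rest]. *)
Lemma pind_le1_choosable : pind_le (AG R o) 1 -> choosable R G 2 2.
Proof.
case=> c [per_neq0 c_le1] L L_vertex L_edge.
have c_inj : injective c.
  move=> i j cij; have /card_le1P := c_le1 (c i); move/(_ i).
  by rewrite inE eqxx => /(_ isT j); rewrite !inE cij eqxx => /esym/eqP.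
have /fin_all_exists [a a_ex] z :
    exists a, exists b, a != b /\ {subset [:: a; b] <= L z}.
  have Lz : #|` L z| = 2 by case: z.
  case: (L z) Lz => -[|a [|b [|? ?]]] //= s_can _.
  exists a, b; split=> //.
  have := canonical_uniq s_can.
  by rewrite /= inE andbT.
have [b abL] := fin_all_exists a_ex.
pose delta j := b (enum_val (c j)) - a (enum_val (c j)).
pose A := \matrix_(i, j) (AG R o i (c j)).
pose rest i := \sum_z AG_entry R o (edge_row i) z * a z.
have [|S SP] :=
    @permanent_neq0_subset R _ (\matrix_(i, j) (A i j * delta j)) rest.
  rewrite permanent_scale_col => /eqP; rewrite mulf_eq0 => /orP [/eqP //|].
  apply/negP/prodf_neq0 => j _; rewrite subr_eq0 eq_sym.
  by case: (abL (enum_val (c j))).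
pose chosen := [set enum_val (c j) | j in S].
exists (fun z => if z \in chosen then b z else a z); split; last first.
  move=> z; have [_ subL] := abL z.
  by case: ifP => _; apply: subL; rewrite !inE eqxx ?orbT.
apply: AG_entry_proper => f.
have := SP (enum_rank f); congr (_ <> 0).
rewrite /rest /edge_row enum_rankK.
transitivity (\sum_z AG_entry R o f z * a z
    + \sum_(z in chosen) AG_entry R o f z * (b z - a z)).
  congr (_ + _); rewrite big_imset /=; last first.
    by move=> i j _ _ /enum_val_inj /c_inj.
  by apply: eq_bigr => j _; rewrite !mxE enum_rankK.
rewrite [X in _ + X]big_mkcond -big_split; apply: eq_bigr => z _ /=.
by case: ifP => _; rewrite ?addr0 // -mulrDr addrC subrK.
Qed.

End Incidence.

(** * A nonzero permanent for unicyclic graphs *)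

Section UnicyclicPermanent.
Local Open Scope ring_scope.
Variables (R : realType) (U : sgraph) (o : edge U -> U * U).
Hypothesis oP : orientation o.
Variables (e : edge U) (h : edge U -> U) (v : U) (p : U -> U) (d : U -> nat).
Hypothesis h_bij : bijective h.
Hypothesis v_neq : v != h e.
Hypothesis eE : val e = [set h e; v].
Hypothesis treeP :
  forall f, f != e -> val f = [set h f; p (h f)] /\ (d (p (h f)) < d (h f))%N.

(** [h] lists every vertex once; [head] lists [v] twice and leaves out the
    root [h e]. *)
Definition head f := if f == e then v else h f.

Lemma head_in f : head f \in val f.
Proof.
rewrite /head; case: eqVneq => [->|/treeP [-> _]]; last by rewrite set21.
by rewrite eE set22.
Qed.

Lemma head_neq_root f : head f != h e.
Proof.
rewrite /head; case: (eqVneq f e) => // fe.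
by apply: contraNneq fe => /(bij_inj h_bij) ->.
Qed.

(** [fun f => head (g f)] directs each edge to one of its ends, with the same
    indegrees as [head].  As the root has indegree zero, [e] must be directed to
    [v].  By induction on the depth, an edge [f] directed to its upper end
    [p (h f)] would share this end with the tree edge [f'] just above it; this
    is impossible unless the end is [v], and then [e], [f] and [f'] would be
    three edges directed to [v], which has indegree two. *)
Lemma head_rigid (g : edge U -> edge U) : injective g ->
  (forall f, head (g f) \in val f) -> forall f, head (g f) = head f.
Proof.
move=> g_inj gP; have [k hK kK] := h_bij.
have e_v : head (g e) = v.
  by have := gP e; rewrite eE !inE (negbTE (head_neq_root _)) /= => /eqP.
have head_vE f : head f = v -> f = e \/ f = k v.
  by rewrite /head; case: eqVneq => [|_ <-]; [left | right; rewrite hK].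
have head_inj f f' : head f = head f' -> head f != v -> f = f'.
  rewrite /head; case: (eqVneq f e) => _; first by rewrite eqxx.
  case: (eqVneq f' e) => _ hE; first by rewrite hE eqxx.
  by move=> _; apply: (bij_inj h_bij).
suff main n : forall f, f != e -> d (h f) = n -> head (g f) = head f.
  move=> f; have [->|fe] := eqVneq f e; last exact: main.
  by rewrite e_v /head eqxx.
elim/ltn_ind: n => n IH f fe dn; have [fE dp] := treeP fe.
have := gP f; rewrite fE => /set2P [-> |gp]; first by rewrite /head (negbTE fe).
exfalso.
have p_root : p (h f) != h e by rewrite -gp head_neq_root.
have [f' f'E] : exists f', h f' = p (h f) by exists (k (p (h f))); rewrite kK.
have f'e : f' != e by apply: contraNneq p_root => <-; rewrite f'E.
have gf' : head (g f') = p (h f).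
  rewrite (IH (d (p (h f)))) -?dn // ?f'E //.
  by rewrite /head (negbTE f'e) f'E.
have ff' : f' != f by apply: contraTneq dp => ff'; rewrite -f'E ff' ltnn.
have [pv|pv] := eqVneq (p (h f)) v; last first.
  case/eqP: ff'; apply: g_inj; apply: head_inj; first by rewrite gf' gp.
  by rewrite gf'.
rewrite pv in gp gf'.
(* [g] maps [e], [f] and [f'] into the two edges with head [v], so two of them
   have the same image. *)
case/head_vE: (e_v) => eg; case/head_vE: (gp) => fg; case/head_vE: (gf') => f'g;
  first [ by case/eqP: fe; apply: g_inj; congruence
        | by case/eqP: f'e; apply: g_inj; congruence
        | by case/eqP: ff'; apply: g_inj; congruence ].
Qed.

Lemma permanent_head_neq0 :
  permanent (column_matrix R o (fun f => inl (head f))) != 0.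
Proof.
pose w i := AG_entry R o (edge_row i) (inl (head (edge_row i))).
apply: (permanent_rigid (w := w)).
- by move=> i; rewrite AG_entry_vertex_neq0 // head_in.
- by exists 1%g => i; rewrite perm1 mxE.
move=> s s_neq0 i; rewrite mxE.
pose g f := edge_row (s (enum_rank f)).
have g_inj : injective g by move=> f f' /enum_val_inj /perm_inj /enum_rank_inj.
have gE j : edge_row (s j) = g (edge_row j) by rewrite /g enum_valK.
rewrite gE (head_rigid g_inj) // => f; have := s_neq0 (enum_rank f).
by rewrite mxE AG_entry_vertex_neq0 // /edge_row enum_rankK.
Qed.

Definition with_cycle_edge f : velt U := if f == e then inr e else inl (h f).

(** The column of [e] is the sum of the columns of [h e] and [v], the three
    matrices being equal elsewhere. *)
Lemma permanent_cycle_edge :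
  permanent (column_matrix R o with_cycle_edge)
  = permanent (column_matrix R o (fun f => inl (h f)))
    + permanent (column_matrix R o (fun f => inl (head f))).
Proof.
have row_neq j : j != enum_rank e -> edge_row j == e = false.
  by move=> je; apply: contraNF je => /eqP <-; rewrite /edge_row enum_valK.
apply: (permanentD_col (k := enum_rank e)) => [i|i j /row_neq je|i j /row_neq je];
  rewrite !mxE /with_cycle_edge /head ?je //.
by rewrite /edge_row enum_rankK eqxx (AG_entry_edge _ oP _ eE).
Qed.

Lemma rooted_pind_le1 : pind_le (AG R o) 1.
Proof.
have [per0|] := eqVneq (permanent (column_matrix R o (fun f => inl (h f)))) 0.
  apply: (pind_le1 (c := with_cycle_edge)); last first.
    apply/eqP.
    by rewrite permanent_cycle_edge per0 add0r permanent_head_neq0.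
  move=> f f'; rewrite /with_cycle_edge.
  by case: eqVneq => [->|_]; case: eqVneq => [->|_] // -[] /(bij_inj h_bij).
by move/eqP; apply: pind_le1 => f f' -[] /(bij_inj h_bij).
Qed.

End UnicyclicPermanent.

Theorem theorem3p8 (R : realType) (U : sgraph) (n : nat)
  (Un : #|vertex U| = n) (hU : unicyclic U) :
  (forall o : edge U -> vertex U * vertex U,
      orientation o -> is_pind (AG R o) 1) /\
  choosable R U 2 2.
Proof.
have [e [h [v [p [d [h_bij v_neq eE treeP]]]]]] := unicyclic_rooted hU.
have le1 (o : edge U -> U * U) (oP : orientation o) : pind_le (AG R o) 1.
  exact: (rooted_pind_le1 R oP h_bij v_neq eE treeP).
split=> [o oP|]; last first.
  have [o oP] := orientation_exists U.
  by apply: (pind_le1_choosable oP); apply: le1.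
split=> [|k [c [_ ck]]]; first exact: le1.
apply: leq_trans (ck (c (enum_rank e))).
by apply/card_gt0P; exists (enum_rank e); rewrite inE eqxx.
Qed.
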